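(* For all positive integers $p,q$, \[ L_s(p,q) \geq 2^{\frac{pq(q-1)}{2}}\, N_s(q)^{\frac{p(p-1)}{2}} - 1. \]
   Context: All graphs are simple undirected labeled graphs on the vertex set $\{1,\dots,n\}$. For such a graph with adjacency matrix $W$ and degree matrix $D$, its Laplacian is $L = D - W$; if the graph has at least one edge, its normalized Laplacian matrix is $\frac{1}{\mathrm{Tr}(L)}L$, which is a density matrix (Hermitian, positive semidefinite, trace $1$). An $n\times n$ density matrix $\rho$ with $n=pq$ is separable in $\mathbb{C}^p\otimes\mathbb{C}^q$ if $\rho=\sum_i c_i\,\rho_i\otimes\eta_i$ (finite sum) where the $\rho_i$ are $p\times p$ density matrices, the $\eta_i$ are $q\times q$ density matrices, $c_i\ge 0$ and $\sum_i c_i=1$; otherwise it is entangled. $L_s(p,q)$ denotes the number of labeled graphs on $n=pq$ vertices with at least one edge whose normalized Laplacian matrix is separable in $\mathbb{C}^p\otimes\mathbb{C}^q$, and $L_e(p,q)$ the number of those whose normalized Laplacian is entangled; thus $L_s(p,q)+L_e(p,q)=L(pq):=2^{pq(pq-1)/2}-1$. A square matrix is line sum symmetric if for each $i$ its $i$-th row sum equals its $i$-th column sum. $N_s(n)$ denotes the number of $n\times n$ matrices with entries in $\{0,1\}$ that are line sum symmetric, and $N_e(n)=2^{n^2}-N_s(n)$ the number of $n\times n$ $0$-$1$ matrices that are not line sum symmetric. *)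

(* Defs.v *)
From HB Require Import structures.
From mathcomp Require Import all_boot all_order all_algebra.
Set Implicit Arguments. Unset Strict Implicit. Unset Printing Implicit Defensive.
Import Order.TTheory GRing.Theory Num.Theory.
Local Open Scope ring_scope.
From Stdlib Require Import ClassicalEpsilon.

Definition asbool (P : Prop) : bool :=
  if excluded_middle_informative P then true else false.

Definition simple_graph n (W : 'M[bool]_n) : bool :=
  [forall i, ~~ W i i] && [forall i, forall j, W i j == W j i].

Definition has_edge n (W : 'M[bool]_n) : bool := [exists i, exists j, W i j].

Definition deg n (W : 'M[bool]_n) (i : 'I_n) : nat := #|[set j | W i j]|.

Definition laplacian (C : numClosedFieldType) n (W : 'M[bool]_n) : 'M[C]_n :=
  \matrix_(i, j) ((if i == j then (deg W i)%:R else 0) - (W i j)%:R).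

Definition norm_laplacian (C : numClosedFieldType) n (W : 'M[bool]_n) : 'M[C]_n :=
  (\tr (laplacian C W))^-1 *: laplacian C W.

Definition psdmx (C : numClosedFieldType) n (M : 'M[C]_n) : Prop :=
  forall v : 'rV[C]_n, 0 <= (v *m M *m (map_mx Num.conj (v^T))) 0 0.

Definition density_matrix (C : numClosedFieldType) n (M : 'M[C]_n) : Prop :=
  [/\ M \is hermsymmx, psdmx M & \tr M = 1].

(* index splitting 'I_(p*q) ~ 'I_p * 'I_q (inverse of mathcomp's mxvec_index) *)
Definition split_index p q (k : 'I_(p * q)) : 'I_p * 'I_q :=
  enum_val (cast_ord (esym (mxvec_cast p q)) k).

Definition kron (C : numClosedFieldType) p q (A : 'M[C]_p) (B : 'M[C]_q)
  : 'M[C]_(p * q) :=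
  \matrix_(k, l) (A (split_index k).1 (split_index l).1 *
                  B (split_index k).2 (split_index l).2).

Definition separable (C : numClosedFieldType) p q (rho : 'M[C]_(p * q)) : Prop :=
  exists (m : nat) (c : 'I_m -> C) (r : 'I_m -> 'M[C]_p) (e : 'I_m -> 'M[C]_q),
    [/\ forall i, 0 <= c i,
        \sum_(i < m) c i = 1,
        forall i, density_matrix (r i),
        forall i, density_matrix (e i) &
        rho = \sum_(i < m) c i *: kron (r i) (e i)].

Definition Ls (C : numClosedFieldType) (p q : nat) : nat :=
  #|[pred W : 'M[bool]_(p * q) |
      simple_graph W && has_edge W &&
      asbool (separable (norm_laplacian C W))]|.

Definition line_sum_symmetric n (A : 'M[bool]_n) : bool :=
  [forall i, (\sum_j (A i j : nat) == \sum_j (A j i : nat))%N].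

Definition Ns (n : nat) : nat := #|[pred A : 'M[bool]_n | line_sum_symmetric A]|.

(* Main.v *)
(** A graph on [p * q] vertices whose [q x q] adjacency blocks are all line sum
    symmetric has a separable normalized Laplacian: twice the Laplacian is the sum,
    over all ordered pairs [(a, b)], of the Laplacians of the blocks [A_ab]. A line
    sum symmetric 0-1 matrix is a balanced digraph, so some permutation of its arcs
    sends each arc to one starting where it ends; diagonalizing this unitary and
    projecting arcs to their tails gives vectors [y_l] and unit numbers [d_l] with
    [sum_l y_l^* y_l] the degree matrix and [sum_l d_l y_l^* y_l = A_ab]. The block
    Laplacian is then the sum of the projections on [(e_a - d_l e_b) (x) y_l].
    Such graphs are obtained by choosing freely the [p] simple graphs on the diagonal
    and the [p (p - 1) / 2] line sum symmetric blocks above it. *)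
Require Import Defs.
From HB Require Import structures.
From mathcomp Require Import all_boot all_order all_algebra all_fingroup ring.
Set Implicit Arguments. Unset Strict Implicit. Unset Printing Implicit Defensive.
Import Order.TTheory GRing.Theory Num.Theory.
Local Open Scope ring_scope.
Local Open Scope sesquilinear_scope.

(** * Pair indices and the trace of a Kronecker product *)

Lemma split_indexK p q (i : 'I_p) (j : 'I_q) : split_index (mxvec_index i j) = (i, j).
Proof. by rewrite /split_index /mxvec_index cast_ordK enum_rankK. Qed.

Lemma sum_mxvec_index (V : nmodType) p q (F : 'I_(p * q) -> V) :
  \sum_k F k = \sum_i \sum_j F (mxvec_index i j).
Proof.
by rewrite pair_big (reindex _ (curry_mxvec_bij p q)); apply: eq_bigr => -[].
Qed.

Lemma mxtrace_kron (C : numClosedFieldType) p q (A : 'M[C]_p) (B : 'M[C]_q) :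
  \tr (kron A B) = \tr A * \tr B.
Proof.
rewrite /mxtrace sum_mxvec_index mulr_suml; apply: eq_bigr => i _.
by rewrite mulr_sumr; apply: eq_bigr => j _; rewrite mxE split_indexK.
Qed.

(** * Rank-one matrices and the cone of unnormalized separable matrices *)

Definition rank1 (C : numClosedFieldType) n (x : 'rV[C]_n) : 'M[C]_n := x^t* *m x.

Section SeparableCone.
Variables (C : numClosedFieldType) (p q : nat).

Lemma rank1E n (x : 'rV[C]_n) i j : rank1 x i j = (x 0 i)^* * x 0 j.
Proof. by rewrite !mxE big_ord1 !mxE. Qed.

Lemma mxtrace_rank1 n (x : 'rV[C]_n) : \tr (rank1 x) = \sum_i `|x 0 i| ^+ 2.
Proof. by apply: eq_bigr => i _; rewrite rank1E normCK mulrC. Qed.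

Lemma mxtrace_rank1_ge0 n (x : 'rV[C]_n) : 0 <= \tr (rank1 x).
Proof. by rewrite mxtrace_rank1 sumr_ge0 // => i _; rewrite exprn_ge0 ?normr_ge0. Qed.

Lemma mxtrace_rank1_eq0 n (x : 'rV[C]_n) : (\tr (rank1 x) == 0) = (x == 0).
Proof.
rewrite mxtrace_rank1 psumr_eq0; last by move=> i _; rewrite exprn_ge0 ?normr_ge0.
apply/allP/eqP => [x0|-> i _]; last by rewrite mxE normr0 expr0n eqxx implybT.
apply/rowP => i; have := x0 i; rewrite mem_index_enum !mxE sqrf_eq0 normr_eq0.
by move=> /(_ isT)/eqP.
Qed.

Lemma density_rank1 n (x : 'rV[C]_n) : x != 0 ->
  density_matrix ((\tr (rank1 x))^-1 *: rank1 x).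
Proof.
move=> x0; have t0 : 0 <= (\tr (rank1 x))^-1 by rewrite invr_ge0 mxtrace_rank1_ge0.
split.
- apply/is_hermitianmxP; rewrite expr0 scale1r; apply/matrixP => i j.
  rewrite mxE rank1E 3!mxE rank1E !rmorphM /= conjCK (CrealP (ger0_real t0)).
  by congr (_ * _); rewrite mulrC.
- move=> v; rewrite -scalemxAr -scalemxAl mxE mulr_ge0 //.
  (* The quadratic form is [z * z^*] for the scalar [z = v *m x^t*]. *)
  have -> : v *m rank1 x *m v^t* = (v *m x^t*) *m (x *m v^t*) by rewrite !mulmxA.
  rewrite mxE big_ord1.
  suff -> : (x *m v^t*) 0 0 = ((v *m x^t*) 0 0)^* by apply: mul_conjC_ge0.
  by rewrite !mxE rmorph_sum; apply: eq_bigr => i _; rewrite !mxE rmorphM /= conjCK mulrC.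
- by rewrite mxtraceZ mulVf // mxtrace_rank1_eq0.
Qed.

(** Separability with the weights left unnormalized: this version is closed under sums and
    nonnegative scaling. *)
Definition sep_cone (M : 'M[C]_(p * q)) : Prop :=
  exists (m : nat) (c : 'I_m -> C) (r : 'I_m -> 'M[C]_p) (e : 'I_m -> 'M[C]_q),
    [/\ forall i, 0 <= c i, forall i, density_matrix (r i),
        forall i, density_matrix (e i) &
        M = \sum_(i < m) c i *: kron (r i) (e i)].

(** All the Kronecker factors have trace 1, so the trace of the combination is the sum of its
    weights. *)
Lemma sep_cone_separable M : sep_cone M -> \tr M = 1 -> separable M.
Proof.
move=> [m [c [r [e [c0 rD eD defM]]]]] trM; exists m, c, r, e; split=> //.
rewrite -trM defM raddf_sum; apply: eq_bigr => i _ /=.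
by rewrite mxtraceZ mxtrace_kron; case: (rD i) (eD i) => _ _ -> [_ _ ->]; rewrite !mulr1.
Qed.

Lemma sep_cone0 : sep_cone 0.
Proof.
by exists 0, (fun=> 0), (fun=> 0), (fun=> 0); split=> [[]|[]|[]|] //; rewrite big_ord0.
Qed.

Lemma sep_coneD M N : sep_cone M -> sep_cone N -> sep_cone (M + N).
Proof.
move=> [m [c [r [e [c0 rD eD ->]]]]] [n [d [s [f [d0 sD fD ->]]]]].
pose cat T (g : 'I_m -> T) (h : 'I_n -> T) (k : 'I_(m + n)) :=
  match split k with inl i => g i | inr j => h j end.
exists (m + n)%N, (cat _ c d), (cat _ r s), (cat _ e f).
split=> [k|k|k|]; try by rewrite /cat; case: (split k).
rewrite big_split_ord /cat; congr (_ + _); apply: eq_bigr => i _ /=.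
  by rewrite -/(unsplit (inl i)) unsplitK.
by rewrite -/(unsplit (inr i)) unsplitK.
Qed.

Lemma sep_cone_sum (I : finType) (F : I -> 'M[C]_(p * q)) :
  (forall i, sep_cone (F i)) -> sep_cone (\sum_i F i).
Proof. by move=> hF; apply: big_ind => //; [apply: sep_cone0 | apply: sep_coneD]. Qed.

Lemma sep_coneZ a M : 0 <= a -> sep_cone M -> sep_cone (a *: M).
Proof.
move=> a0 [m [c [r [e [c0 rD eD ->]]]]]; exists m, (fun i => a * c i), r, e.
split=> // [i|]; first by rewrite mulr_ge0.
by rewrite scaler_sumr; apply: eq_bigr => i _; rewrite scalerA.
Qed.

(** Each factor divided by its trace is a density matrix, and the product of the two traces is the
    weight. A zero vector cannot be normalized, but then the product vanishes. *)
Lemma sep_cone_kron_rank1 (x : 'rV[C]_p) (y : 'rV[C]_q) :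
  sep_cone (kron (rank1 x) (rank1 y)).
Proof.
have [->|x0] := eqVneq x 0.
  suff -> : kron (rank1 0) (rank1 y) = 0 :> 'M[C]_(p * q) by apply: sep_cone0.
  by apply/matrixP => k l; rewrite mxE rank1E !mxE mulr0 mul0r.
have [->|y0] := eqVneq y 0.
  suff -> : kron (rank1 x) (rank1 0) = 0 :> 'M[C]_(p * q) by apply: sep_cone0.
  by apply/matrixP => k l; rewrite mxE [X in _ * X]rank1E !mxE !mulr0.
have tx : \tr (rank1 x) != 0 by rewrite mxtrace_rank1_eq0.
have ty : \tr (rank1 y) != 0 by rewrite mxtrace_rank1_eq0.
exists 1%N, (fun=> \tr (rank1 x) * \tr (rank1 y)),
  (fun=> (\tr (rank1 x))^-1 *: rank1 x), (fun=> (\tr (rank1 y))^-1 *: rank1 y).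
split=> [_|_|_|]; rewrite ?mulr_ge0 ?mxtrace_rank1_ge0 //; try exact: density_rank1.
rewrite big_ord1; apply/matrixP => k l.
rewrite [LHS]mxE [RHS]mxE [X in _ = _ * X]mxE.
rewrite [X in _ * (X * _)]mxE [X in _ * (_ * X)]mxE.
by rewrite mulrACA !mulVKf.
Qed.

End SeparableCone.

(** * Line sum symmetric matrices through a permutation of arcs *)

(** Fibers of equal size mean that the value lists of [f] and [g] agree as multisets, hence up to a
    permutation of positions. *)
Lemma equal_fibers_perm (V : eqType) m (f g : 'I_m -> V) :
  (forall v, #|[pred a | f a == v]| = #|[pred a | g a == v]|) ->
  exists s : 'S_m, forall a, g (s a) = f a.
Proof.
move=> fg; pose tup (h : 'I_m -> V) := [tuple h a | a < m].
have /tuple_permP [s hs] : perm_eq (tup f) (tup g).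
  apply/allP => v _ /=; apply/eqP; rewrite !count_map.
  by have := fg v; rewrite !cardE !size_filter /enum_mem -!enumT !count_filter.
exists s => a; have := congr1 (fun t => nth (f a) t a) hs.
by rewrite -!tnth_nth !tnth_mktuple.
Qed.

(* Non-arcs are kept as indices, labelled [None], so that the index set is all pairs. *)
Lemma line_sum_symmetric_dilation (C : numClosedFieldType) q (A : 'M[bool]_q) :
  line_sum_symmetric A ->
  exists (m : nat) (d : 'rV[C]_m) (Y : 'M[C]_(m, q)),
    [/\ forall l, (d 0 l)^* * d 0 l = 1,
        Y^t* *m Y = diag_mx (\row_u (\sum_v (A u v : nat))%:R) &
        Y^t* *m diag_mx d *m Y = \matrix_(u, v) (A u v)%:R].
Proof.
move=> /forallP lssA; pose m := #|{: 'I_q * 'I_q}|.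
pose arc (a : 'I_m) : 'I_q * 'I_q := enum_val a.
pose label (h : 'I_q * 'I_q -> 'I_q) e := if A e.1 e.2 then Some (h e) else None.
have sum_arc (G : 'I_q * 'I_q -> nat) : (\sum_a G (arc a) = \sum_u \sum_v G (u, v))%N.
  rewrite pair_big /=; transitivity (\sum_(e in {: 'I_q * 'I_q}) G e)%N.
    by rewrite [RHS]big_enum_val.
  by apply: eq_big => -[].
have labelE h e u : (label h e == Some u) = A e.1 e.2 && (h e == u).
  by rewrite /label; case: (A _ _) => //; rewrite (inj_eq Some_inj).
have sum_tail u (G : 'I_q * 'I_q -> nat) :
    (\sum_a (label fst (arc a) == Some u) * G (arc a) = \sum_w A u w * G (u, w))%N.
  rewrite (sum_arc (fun e => (label fst e == Some u) * G e)%N).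
  rewrite (bigD1 u) //= [X in (_ + X)%N]big1 ?addn0 => [|w /negPf wu].
    by apply: eq_bigr => w _; rewrite labelE /= eqxx andbT.
  by rewrite big1 // => v _; rewrite labelE /= wu andbF.
have sum_head v (G : 'I_q * 'I_q -> nat) :
    (\sum_a (label snd (arc a) == Some v) * G (arc a) = \sum_w A w v * G (w, v))%N.
  rewrite (sum_arc (fun e => (label snd e == Some v) * G e)%N).
  apply: eq_bigr => u _; rewrite (bigD1 v) //= big1 ?addn0 => [|w /negPf wv].
    by rewrite labelE /= eqxx andbT.
  by rewrite labelE /= wv andbF.
(* The fibers over [Some v] count the arcs entering and leaving [v], which are the column and row
   sums at [v]; those over [None] both count the non-arcs. *)
have [s hs] : exists s : 'S_m, forall a, label fst (arc (s a)) = label snd (arc a).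
  apply: (@equal_fibers_perm _ m (fun a => label snd (arc a)) (fun a => label fst (arc a))).
  case=> [v|]; last first.
    by apply: eq_card => a; rewrite !inE /label; case: ifP.
  rewrite -!sum1_card [LHS]big_mkcond [RHS]big_mkcond.
  transitivity (\sum_w (A w v * 1))%N.
    by rewrite -(sum_head v (fun=> 1%N)); apply: eq_bigr => a _; rewrite muln1 inE; case: eqP.
  transitivity (\sum_w (A v w * 1))%N.
    under eq_bigr do rewrite muln1; under [RHS]eq_bigr do rewrite muln1.
    by rewrite (eqP (lssA v)).
  by rewrite -(sum_tail v (fun=> 1%N)); apply: eq_bigr => a _; rewrite muln1 inE; case: eqP.
(* Row [a] is the indicator of the tail of the arc [a], and is zero for a non-arc. *)
pose V : 'M[C]_(m, q) := \matrix_(a, v) (label fst (arc a) == Some v)%:R.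
have Vconj : V^t* = V^T.
  by apply/matrixP => i j; rewrite !mxE conjC_nat.
pose P : 'M[C]_m := perm_mx s.
have Pconj : P^t* = P^T by apply/matrixP => i j; rewrite !mxE conjC_nat.
have PP : P *m P^t* = 1%:M by rewrite Pconj tr_perm_mx -perm_mxM mulgV perm_mx1.
have Pnormal : P \is normalmx by apply/normalmxP; rewrite PP (mulmx1C PP).
pose S := spectralmx P; pose d := spectral_diag P.
have SS : S *m S^t* = 1%:M by apply/unitarymxP/spectral_unitarymx.
have SS' : S^t* *m S = 1%:M by apply: mulmx1C.
have defP : P = S^t* *m diag_mx d *m S.
  by rewrite -invmx_unitary ?spectral_unitarymx //; apply/orthomx_spectralP.
(* As [S] is unitary and diagonalizes [P], the two Gram-type products become [V^T *m V] and
   [V^T *m P *m V]. *)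
exists m, d, (S *m V).
have YE : (S *m V)^t* = V^T *m S^t* by rewrite trmx_mul map_mxM /= Vconj.
split.
(* [diag_mx d] is a product of unitary matrices, so its diagonal entries have modulus 1. *)
- have dP : diag_mx d = S *m P *m S^t*.
    by rewrite defP !mulmxA SS mul1mx -mulmxA SS mulmx1.
  have : diag_mx d *m (diag_mx d)^t* = 1%:M.
    rewrite dP !trmx_mul !map_mxM /= trmxCK !mulmxA -[_ *m S^t* *m S]mulmxA SS' mulmx1.
    by rewrite -[_ *m P *m _]mulmxA PP mulmx1 SS.
  move=> /matrixP dd l; have := dd l l.
  rewrite tr_diag_mx map_diag_mx mul_diag_mx !mxE eqxx !mulr1n => <-.
  by rewrite mulrC.
- rewrite YE mulmxA -[_ *m S^t* *m S]mulmxA SS' mulmx1.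
  apply/matrixP => u v; rewrite !mxE.
  under [LHS]eq_bigr do rewrite !mxE -natrM.
  rewrite -natr_sum -mulrnA (sum_tail u (fun e => label fst e == Some v)).
  have [<-|uv] := eqVneq; rewrite ?muln1 ?muln0; congr _%:R.
    by apply: eq_bigr => w _; rewrite labelE /= eqxx andbT; case: (A u w).
  by rewrite big1 // => w _; rewrite labelE /= (negPf uv) andbF muln0.
- rewrite YE !mulmxA.
  have -> : V^T *m S^t* *m diag_mx d *m S *m V = V^T *m (P *m V) by rewrite defP !mulmxA.
  (* Row [a] of [P *m V] is row [s a] of [V], the indicator of the head of [a]; the product
     therefore counts arcs from [u] to [v]. *)
  apply/matrixP => u v; rewrite /P -row_permE !mxE.
  under [LHS]eq_bigr do rewrite !mxE hs -natrM.
  rewrite -natr_sum (sum_tail u (fun e => label snd e == Some v)).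
  rewrite (bigD1 v) //= big1 ?addn0 => [|w /negPf wv].
    by rewrite labelE /= eqxx andbT; case: (A u v).
  by rewrite labelE /= wv andbF muln0.
Qed.

(** * Decomposition of the Laplacian into block Laplacians *)

Definition block p q (W : 'M[bool]_(p * q)) (a b : 'I_p) : 'M[bool]_q :=
  \matrix_(u, v) W (mxvec_index a u) (mxvec_index b v).

(* Laplacian of the edges joining [(a, u)] to [(b, v)] whenever [A u v]; for [a = b]
   and [A] symmetric each edge is counted twice. *)
Definition block_laplacian (C : numClosedFieldType) p q (a b : 'I_p) (A : 'M[bool]_q) :
    'M[C]_(p * q) :=
  \matrix_(k, l)
    let: (i, u) := split_index k in let: (j, v) := split_index l in
    (((i == a) && (j == a))%:R + ((i == b) && (j == b))%:R)
      * ((\sum_w (A u w : nat))%:R *+ (u == v))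
    - ((i == a) && (j == b))%:R * (A u v)%:R - ((i == b) && (j == a))%:R * (A v u)%:R.

Lemma sep_cone_block_laplacian (C : numClosedFieldType) p q (a b : 'I_p) (A : 'M[bool]_q) :
  line_sum_symmetric A -> sep_cone (block_laplacian C a b A).
Proof.
move=> /(line_sum_symmetric_dilation C) [m [d [Y [d1 degA defA]]]].
have degE u v : \sum_l (Y l u)^* * Y l v = (\sum_w (A u w : nat))%:R *+ (u == v).
  by have /matrixP/(_ u v) := degA; rewrite !mxE => <-; apply: eq_bigr => l _; rewrite !mxE.
have AE u v : \sum_l d 0 l * ((Y l u)^* * Y l v) = (A u v)%:R.
  have /matrixP/(_ u v) := defA; rewrite mul_mx_diag !mxE => <-.
  by apply: eq_bigr => l _; rewrite !mxE mulrA [_ * d _ _]mulrC.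
(* Conjugating [AE] exchanges [u] and [v], while the entries of [A] are real. *)
have ATE u v : \sum_l (d 0 l)^* * ((Y l u)^* * Y l v) = (A v u)%:R.
  rewrite -[RHS]conjC_nat -AE rmorph_sum; apply: eq_bigr => l _.
  by rewrite !rmorphM /= conjCK [_^* * Y _ _]mulrC.
(* In [rank1 (x l)] the diagonal terms have coefficients 1 and [(d 0 l)^* * d 0 l = 1], the cross
   terms [- d 0 l] and [- (d 0 l)^*]; summed against the [Y] products they give the row sums, [A]
   and its transpose. *)
pose x l : 'rV[C]_p := delta_mx 0 a - d 0 l *: delta_mx 0 b.
suff -> : block_laplacian C a b A = \sum_l kron (rank1 (x l)) (rank1 (row l Y)).
  by apply: sep_cone_sum => l; apply: sep_cone_kron_rank1.
apply/matrixP => k l; case: (mxvec_indexP k) => i u; case: (mxvec_indexP l) => j v.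
rewrite mxE !split_indexK summxE -degE -AE -ATE !mulr_sumr -!sumrB.
apply: eq_bigr => t _; rewrite mxE !split_indexK !rank1E !mxE !eqxx /=.
rewrite rmorphB rmorphM /= !conjC_nat -!mulnb !natrM.
set y := _^* * Y t v.
transitivity (((i == a)%:R * (j == a)%:R + ((d 0 t)^* * d 0 t) * ((i == b)%:R * (j == b)%:R)
    - d 0 t * ((i == a)%:R * (j == b)%:R) - (d 0 t)^* * ((i == b)%:R * (j == a)%:R)) * y);
  last by ring.
by rewrite d1; ring.
Qed.

(** An edge between different blocks is met for [(a, b)] and for [(b, a)], and an edge inside a
    block is counted twice there: hence the factor one half. *)
Lemma laplacian_blocks (C : numClosedFieldType) p q (W : 'M[bool]_(p * q)) :
  simple_graph W -> (forall a b, line_sum_symmetric (block W a b)) ->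
  laplacian C W = 2%:R^-1 *: \sum_a \sum_b block_laplacian C a b (block W a b).
Proof.
move=> /andP[_ /forallP symW] lssW.
have WC k l : W k l = W l k by apply/eqP; have /forallP := symW k.
have degE i u : (deg W (mxvec_index i u) = \sum_b \sum_w (block W i b u w : nat))%N.
  rewrite /deg -sum1dep_card big_mkcond sum_mxvec_index.
  by apply: eq_bigr => b _; apply: eq_bigr => w _; rewrite mxE; case: (W _ _).
(* The part of [block_laplacian] located at its second index also uses row sums, where column sums
   would be expected; line sum symmetry makes them agree. *)
have degE' i u : (deg W (mxvec_index i u) = \sum_a \sum_w (block W a i u w : nat))%N.
  rewrite degE; apply: eq_bigr => b _; have /forallP/(_ u)/eqP -> := lssW b i.
  by apply: eq_bigr => w _; rewrite !mxE WC.
apply/(scalerI (a := 2%:R)); first by rewrite pnatr_eq0.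
rewrite scalerA divff ?pnatr_eq0 // scale1r.
apply/matrixP => k l; case: (mxvec_indexP k) => i u; case: (mxvec_indexP l) => j v.
pose deg_block a b := (\sum_w (block W a b u w : nat))%:R *+ (u == v) : C.
have deltaE n (t : 'I_n) (F : 'I_n -> C) : \sum_s (t == s)%:R * F s = F t.
  rewrite (bigD1 t) //= eqxx mul1r big1 ?addr0 // => s /negPf.
  by rewrite eq_sym => ->; rewrite mul0r.
(* With the indicators split into single Kronecker deltas, [deltaE] collapses the sums one index at
   a time. *)
transitivity (\sum_a \sum_b ((i == a)%:R * ((j == a)%:R * deg_block a b)
    + (i == b)%:R * ((j == b)%:R * deg_block a b)
    - (i == a)%:R * ((j == b)%:R * (block W a b u v)%:R)
    - (i == b)%:R * ((j == a)%:R * (block W a b v u)%:R))); last first.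
  rewrite summxE; apply: eq_bigr => a _; rewrite summxE; apply: eq_bigr => b _.
  by rewrite [RHS]mxE !split_indexK mulrDl -!mulnb !natrM !mulrA.
have eq_mxvec : (mxvec_index i u == mxvec_index j v) = (i == j) && (u == v).
  apply/eqP/andP => [/(congr1 (@split_index p q))|[/eqP-> /eqP->] //].
  by rewrite !split_indexK => -[-> ->].
under eq_bigr => a _ do rewrite !sumrB big_split /= -!mulr_sumr !deltaE.
rewrite !sumrB big_split /= !deltaE -mulr_sumr.
rewrite !mxE eq_mxvec [W (mxvec_index j v) _]WC.
have -> : \sum_b deg_block i b = (deg W (mxvec_index i u))%:R *+ (u == v).
  by rewrite sumrMnl -natr_sum -degE.
have -> : \sum_a deg_block a i = (deg W (mxvec_index i u))%:R *+ (u == v).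
  by rewrite sumrMnl -natr_sum -degE'.
by rewrite (eq_sym j i); case: (i == j); case: (u == v) => /=; rewrite ?mulr1n ?mulr0n; ring.
Qed.

Lemma separable_norm_laplacian (C : numClosedFieldType) p q (W : 'M[bool]_(p * q)) :
  simple_graph W -> has_edge W -> (forall a b, line_sum_symmetric (block W a b)) ->
  separable (norm_laplacian C W).
Proof.
move=> sW eW lssW; have /andP[/forallP irrW _] := sW.
have trE : \tr (laplacian C W) = (\sum_k deg W k)%:R.
  rewrite natr_sum; apply: eq_bigr => k _.
  by rewrite mxE eqxx (negPf (irrW k)) subr0.
have tr0 : \tr (laplacian C W) != 0.
  rewrite trE pnatr_eq0 sum_nat_eq0; case/existsP: eW => k /existsP[l Wkl].
  apply/forallPn; exists k; rewrite /= -lt0n; apply/card_gt0P; exists l.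
  by rewrite inE.
apply: sep_cone_separable; last by rewrite mxtraceZ mulVf.
apply: sep_coneZ; first by rewrite invr_ge0 trE ler0n.
rewrite laplacian_blocks //; apply: sep_coneZ; first by rewrite invr_ge0 ler0n.
by do 2![apply: sep_cone_sum => ?]; apply: sep_cone_block_laplacian.
Qed.

(** * Graphs assembled from free data on strict upper triangles *)

Definition upper_pair n := {x : 'I_n * 'I_n | (x.1 < x.2)%N}.

(** Column [j] has [j] positions above the diagonal, and these numbers add up to the binomial
    coefficient. *)
Lemma card_upper_pair n : #|{: upper_pair n}| = 'C(n, 2).
Proof.
rewrite card_sig -bin2_sum big_mkord -sum1_card big_mkcond /=.
rewrite -(pair_big xpredT xpredT (fun i j : 'I_n => if (i < j)%N then 1 else 0)%N) /= exchange_big.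
apply: eq_bigr => j _; rewrite -big_mkcond /=.
by rewrite -(big_ord_widen _ (fun=> 1%N) (ltnW (ltn_ord j))) sum1_card card_ord.
Qed.

(** Extends [f] by the default [z] on and below the diagonal; with a false default, symmetrizing is
    a plain disjunction. *)
Definition upper_fun n T (z : T) (f : upper_pair n -> T) (i j : 'I_n) : T :=
  oapp f z (insub (i, j)).

Lemma upper_fun_pair n T (z : T) (f : upper_pair n -> T) x :
  upper_fun z f (val x).1 (val x).2 = f x.
Proof. by rewrite /upper_fun -surjective_pairing valK. Qed.

Lemma upper_fun_out n T (z : T) (f : upper_pair n -> T) (i j : 'I_n) :
  (j <= i)%N -> upper_fun z f i j = z.
Proof. by move=> ji; rewrite /upper_fun insubF //= ltnNge ji. Qed.

Section Assembly.
Variables p q : nat.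

(** [DB.1] encodes the [p] diagonal graphs and [DB.2] the blocks above the diagonal, transposed
    below it. For given [i] and [j] only one of the three disjuncts can be true. *)
Definition assemble
    (DB : {ffun 'I_p * upper_pair q -> bool} *
          {ffun upper_pair p -> {A : 'M[bool]_q | line_sum_symmetric A}}) :
    'M[bool]_(p * q) :=
  let off := upper_fun (const_mx false) (fun x => val (DB.2 x)) in
  let diag i := upper_fun false (fun x => DB.1 (i, x)) in
  \matrix_(k, l)
    let: (i, u) := split_index k in let: (j, v) := split_index l in
    [|| off i j u v, off j i v u | (i == j) && (diag i u v || diag i v u)].

(** Every free choice can be read off at its upper-triangular position, where all other disjuncts
    are false. *)
Lemma assemble_inj : injective assemble.
Proof.
move=> [D B] [D' B'] /matrixP eqW; congr (_, _); apply/ffunP.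
  move=> [i x]; have := eqW (mxvec_index i (val x).1) (mxvec_index i (val x).2).
  rewrite !mxE !split_indexK /= !(upper_fun_out _ _ (leqnn i)) !mxE eqxx /=.
  have xlt := valP x.
  by rewrite !upper_fun_pair ![upper_fun _ _ (val x).2 _](upper_fun_out _ _ (ltnW xlt)) !orbF.
move=> x; apply/val_inj/matrixP => u v.
have := eqW (mxvec_index (val x).1 u) (mxvec_index (val x).2 v).
have xlt := valP x.
rewrite !mxE !split_indexK /= !upper_fun_pair.
rewrite ![upper_fun _ _ (val x).2 _](upper_fun_out _ _ (ltnW xlt)) mxE.
by rewrite -val_eqE (ltn_eqF xlt) !orbF.
Qed.

Lemma simple_graph_assemble DB : simple_graph (assemble DB).
Proof.
apply/andP; split.
  apply/forallP => k; case: (mxvec_indexP k) => i u.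
  by rewrite mxE split_indexK !upper_fun_out // mxE andbF.
apply/forallP => k; apply/forallP => l; apply/eqP.
case: (mxvec_indexP k) => i u; case: (mxvec_indexP l) => j v.
rewrite !mxE !split_indexK (eq_sym j i) orbCA.
by congr [|| _, _ | _]; have [->|] := eqVneq i j; rewrite //= orbC.
Qed.

(** Above the diagonal the block is a chosen one, below it the transpose of a chosen one, and on it
    a symmetric matrix. *)
Lemma block_assemble_lss DB a b : line_sum_symmetric (block (assemble DB) a b).
Proof.
have blockE u v : block (assemble DB) a b u v =
  [|| upper_fun (const_mx false) (fun x => val (DB.2 x)) a b u v,
      upper_fun (const_mx false) (fun x => val (DB.2 x)) b a v u
    | (a == b) && (upper_fun false (fun x => DB.1 (a, x)) u v
                   || upper_fun false (fun x => DB.1 (a, x)) v u)].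
  by rewrite !mxE !split_indexK.
apply/forallP => u; apply/eqP.
have [ab|ba|/val_inj eq_ab] := ltngtP a b.
- pose x : upper_pair p := exist _ (a, b) ab.
  have /forallP/(_ u)/eqP := valP (DB.2 x).
  have E w w' : block (assemble DB) a b w w' = val (DB.2 x) w w'.
    rewrite blockE (upper_fun_out _ _ (ltnW ab)) mxE -val_eqE (ltn_eqF ab) !orbF.
    by rewrite -(upper_fun_pair (const_mx false) (fun x => val (DB.2 x))).
  by under eq_bigr do rewrite -E; under [RHS]eq_bigr do rewrite -E.
- pose x : upper_pair p := exist _ (b, a) ba.
  have /forallP/(_ u)/eqP := valP (DB.2 x).
  have E w w' : block (assemble DB) a b w w' = val (DB.2 x) w' w.
    rewrite blockE (upper_fun_out _ _ (ltnW ba)) mxE -val_eqE (gtn_eqF ba) orbF.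
    by rewrite -(upper_fun_pair (const_mx false) (fun x => val (DB.2 x))).
  by under eq_bigr do rewrite -E; under [RHS]eq_bigr do rewrite -E.
- by apply: eq_bigr => w _; rewrite !blockE -eq_ab !(upper_fun_out _ _ (leqnn a)) !mxE /= orbC.
Qed.

End Assembly.

(** * Counting the assembled graphs *)

Theorem mainTheorem1 (C : numClosedFieldType) (p q : nat) :
  (0 < p)%N -> (0 < q)%N ->
  (2 ^ (p * q * (q - 1) %/ 2) * Ns q ^ (p * (p - 1) %/ 2) - 1 <= Ls C p q)%N.
Proof.
move=> _ _.
have binE n : (n * (n - 1) %/ 2 = 'C(n, 2))%N by rewrite bin2 subn1 divn2.
(* Evenness lets the factor [p] leave the truncated division by 2. *)
have dvd2 n : (2 %| n * (n - 1))%N.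
  by rewrite dvdn2 oddM; case: n => // n; rewrite subn1 /= andNb.
pose dom := ({ffun 'I_p * upper_pair q -> bool} *
             {ffun upper_pair p -> {A : 'M[bool]_q | line_sum_symmetric A}})%type.
have card_dom : #|{: dom}| = (2 ^ (p * q * (q - 1) %/ 2) * Ns q ^ (p * (p - 1) %/ 2))%N.
  rewrite card_prod !card_ffun card_bool card_prod card_ord !card_upper_pair card_sig.
  by rewrite binE -mulnA -muln_divA ?dvd2 // binE.
rewrite -card_dom -(card_imset _ (@assemble_inj p q)).
set G := [set _ | _ in _].
(* Discarding the edgeless graph, which has no normalized Laplacian, accounts for the [- 1]. *)
apply: leq_trans (_ : #|G :\ const_mx false| <= _)%N.
  by rewrite (cardsD1 (const_mx false) G) leq_subLR leq_add2r leq_b1.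
apply/subset_leq_card/subsetP => W /setD1P[W0 /imsetP[DB _ defW]].
have sW : simple_graph W by rewrite defW simple_graph_assemble.
have eW : has_edge W.
  apply: contraNT W0 => noedge; apply/eqP/matrixP => k l; rewrite mxE.
  by apply: contraNF noedge => Wkl; apply/existsP; exists k; apply/existsP; exists l.
rewrite inE sW eW /= /asbool; case: ClassicalEpsilon.excluded_middle_informative => // -[].
by apply: separable_norm_laplacian => // a b; rewrite defW; apply: block_assemble_lss.
Qed.
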